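(* The first-order theory $\mathrm{ECDA}$ is the model completion of the theory of De Morgan algebras. Moreover, $\mathrm{ECDA}$ is complete and admits elimination of quantifiers (in the language $\{+,\cdot,\bar{\ },0,1\}$ of De Morgan algebras).
   Context: A De Morgan algebra is a structure $(D;+,\cdot,\bar{\ },0,1)$ where $(D;+,\cdot,0,1)$ is a bounded distributive lattice ($+$ is join, $\cdot$ is meet, $0$ smallest, $1$ largest element) and $\bar{\ }$ is a unary operation with $\bar{\bar x}=x$ and $\overline{x+y}=\bar x\cdot\bar y$ for all $x,y$. Convention: $0\neq 1$. It is complemented if $\forall x\exists y\,(xy=0\wedge x+y=1)$. Model completion: a theory $T'$ is a model companion of $T$ if $T'$ is model complete (every formula is equivalent modulo $T'$ to an existential one), every model of $T$ embeds into a model of $T'$, and every model of $T'$ embeds into a model of $T$. If $T$ has the amalgamation property (for models $M_0,M_1,M_2$ of $T$ and embeddings $f_i:M_0\to M_i$, $i=1,2$, there are a model $M$ of $T$ and embeddings $g_i:M_i\to M$ with $g_1f_1=g_2f_2$), a model companion of $T$ is called its model completion. Consistency: for $\sigma\in S_n$, a triple $(I_1,I_2,I_3)$ of subsets of $\{1,\dots,n\}$ is $\sigma$-consistent if $\sigma(I_2)=I_2$, $\sigma(I_3)=I_3$, and $(I_1\cap I_2\cap I_3)\cap\sigma(I_1\cap I_2\cap I_3)=\emptyset$. Formulas: for $y=(y_1,\dots,y_n)$ and $I\subseteq\{1,\dots,n\}$ put $$\tilde\psi^n_I(y,x):=\bigwedge_{i\in I}y_i\cdot x\bar x=0\wedge\bigwedge_{i\notin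 I}y_i\cdot x\bar x\neq0,$$ $$\tilde\xi^n_I(y,x):=\exists z\Big(\bar x+z=1\wedge\bar xz=0\wedge\bigwedge_{i\in I}y_i\cdot xz=0\wedge\bigwedge_{i\notin I}y_i\cdot xz\neq0\Big),$$ $$\tilde\chi^n_I(y,x):=\exists z\Big(x+z=1\wedge xz=0\wedge\bigwedge_{i\in I}y_i\cdot z\bar x=0\wedge\bigwedge_{i\notin I}y_i\cdot z\bar x\neq0\Big),$$ and $\tilde\varphi^n_{(I_1,I_2,I_3)}(y,x):=\tilde\psi^n_{I_1}(y,x)\wedge\tilde\xi^n_{I_2}(y,x)\wedge\tilde\chi^n_{I_3}(y,x)$. The theory $\mathrm{ECDA}$ consists of the axioms of complemented De Morgan algebras and the sentences $$\forall y_1,\dots,y_n\Big(\bigwedge_iy_i\neq0\wedge\sum_{i=1}^ny_i=1\wedge\bigwedge_{i\neq j}y_iy_j=0\wedge\bigwedge_i(\bar y_i+y_{\sigma(i)}=1\wedge\bar y_iy_{\sigma(i)}=0)\rightarrow\exists x\,\tilde\varphi^n_{(I_1,I_2,I_3)}(y,x)\Big)$$ for each integer $n\ge1$, each $\sigma\in S_n$ with $\sigma^2$ the identity, and each $\sigma$-consistent triple $(I_1,I_2,I_3)$ of subsets of $\{1,\dots,n\}$. *)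

(* Defs.v *)
From mathcomp Require Import all_boot all_fingroup.

Set Implicit Arguments.
Unset Strict Implicit.
Unset Printing Implicit Defensive.

(** * First-order logic with equality in the language {+, ., bar, 0, 1} *)

Inductive term : Type :=
  | Var of nat
  | Join of term & term
  | Meet of term & term
  | Bar of term
  | Zero
  | One.

Inductive formula : Type :=
  | FEq of term & term
  | FFalse
  | FAnd of formula & formula
  | FOr of formula & formula
  | FImp of formula & formula
  | FAll of nat & formula
  | FEx of nat & formula.

Definition FNot (p : formula) : formula := FImp p FFalse.
Definition FTrue : formula := FNot FFalse.
Definition FNeq (s t : term) : formula := FNot (FEq s t).

Declare Scope dm_term_scope.
Delimit Scope dm_term_scope with dmt.
Bind Scope dm_term_scope with term.
Notation "s + t" := (Join s t) : dm_term_scope.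
Notation "s * t" := (Meet s t) : dm_term_scope.
Notation "- t" := (Bar t) : dm_term_scope.
Notation "0" := Zero : dm_term_scope.
Notation "1" := One : dm_term_scope.

Declare Scope dm_formula_scope.
Delimit Scope dm_formula_scope with dmf.
Bind Scope dm_formula_scope with formula.
Notation "s == t" := (FEq s%dmt t%dmt) : dm_formula_scope.
Notation "s != t" := (FNeq s%dmt t%dmt) : dm_formula_scope.
Notation "p /\ q" := (FAnd p q) : dm_formula_scope.
Notation "p ==> q" := (FImp p q) : dm_formula_scope.

Arguments FAll _%_nat_scope _%_dmf.
Arguments FEx _%_nat_scope _%_dmf.

(** FAll_n n p is "forall x_0 ... x_(n-1), p". *)
Definition FAll_n (n : nat) (p : formula) : formula := foldr FAll p (iota 0 n).

(** Variables occurring in a term, free variables of a formula. *)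
Fixpoint term_vars (t : term) : seq nat :=
  match t with
  | Var i => [:: i]
  | Join s t | Meet s t => term_vars s ++ term_vars t
  | Bar t => term_vars t
  | Zero | One => [::]
  end.

Fixpoint free_vars (p : formula) : seq nat :=
  match p with
  | FEq s t => term_vars s ++ term_vars t
  | FFalse => [::]
  | FAnd p q | FOr p q | FImp p q => free_vars p ++ free_vars q
  | FAll i p | FEx i p => [seq j <- free_vars p | j != i]
  end.

Definition is_sentence (p : formula) : bool := nilp (free_vars p).

Fixpoint quantifier_free (p : formula) : bool :=
  match p with
  | FEq _ _ | FFalse => true
  | FAnd p q | FOr p q | FImp p q => quantifier_free p && quantifier_free q
  | FAll _ _ | FEx _ _ => false
  end.

(** A block of existential quantifiers in front of a quantifier-free formula. *)
Fixpoint existential (p : formula) : bool :=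
  match p with
  | FEx _ q => existential q
  | _ => quantifier_free p
  end.

(** No equations are imposed here: De Morgan algebras are the structures
    that are models of the theory DMA below. *)
Record structure : Type := Structure {
  carrier :> Type;
  joinS : carrier -> carrier -> carrier;
  meetS : carrier -> carrier -> carrier;
  barS : carrier -> carrier;
  zeroS : carrier;
  oneS : carrier
}.

Fixpoint eval (M : structure) (v : nat -> M) (t : term) : M :=
  match t with
  | Var i => v i
  | Join s t => joinS (eval v s) (eval v t)
  | Meet s t => meetS (eval v s) (eval v t)
  | Bar t => barS (eval v t)
  | Zero => zeroS M
  | One => oneS M
  end.

Definition update (M : Type) (v : nat -> M) (i : nat) (a : M) : nat -> M :=
  fun j => if j == i then a else v j.

Fixpoint sat (M : structure) (v : nat -> M) (p : formula) : Prop :=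
  match p with
  | FEq s t => eval v s = eval v t
  | FFalse => False
  | FAnd p q => sat v p /\ sat v q
  | FOr p q => sat v p \/ sat v q
  | FImp p q => sat v p -> sat v q
  | FAll i p => forall a : M, sat (update v i a) p
  | FEx i p => exists a : M, sat (update v i a) p
  end.

(** * Theories *)

Definition theory : Type := formula -> Prop.

Definition valid_in (M : structure) (p : formula) : Prop :=
  forall v : nat -> M, sat v p.

Definition is_model (T : theory) (M : structure) : Prop :=
  forall p, T p -> valid_in M p.

Definition entails (T : theory) (p : formula) : Prop :=
  forall M, is_model T M -> valid_in M p.

Definition equiv_mod (T : theory) (p q : formula) : Prop :=
  entails T (FAnd (FImp p q) (FImp q p)).

Definition is_embedding (M N : structure) (f : M -> N) : Prop :=
  [/\ injective f,
      {morph f : a b / joinS a b >-> joinS a b},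
      {morph f : a b / meetS a b >-> meetS a b},
      {morph f : a / barS a >-> barS a} &
      f (zeroS M) = zeroS N /\ f (oneS M) = oneS N].

Definition embeds (M N : structure) : Prop :=
  exists f : M -> N, is_embedding f.

Definition model_complete (T : theory) : Prop :=
  forall p, exists q, [/\ existential q,
    {subset free_vars q <= free_vars p} & equiv_mod T p q].

Definition model_companion (T' T : theory) : Prop :=
  [/\ model_complete T',
      forall M, is_model T M -> exists2 N, is_model T' N & embeds M N &
      forall M, is_model T' M -> exists2 N, is_model T N & embeds M N].

Definition amalgamation (T : theory) : Prop :=
  forall (M0 M1 M2 : structure) (f1 : M0 -> M1) (f2 : M0 -> M2),
    is_model T M0 -> is_model T M1 -> is_model T M2 ->
    is_embedding f1 -> is_embedding f2 ->
  exists (M : structure) (g1 : M1 -> M) (g2 : M2 -> M),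
    [/\ is_model T M, is_embedding g1, is_embedding g2 &
        forall a : M0, g1 (f1 a) = g2 (f2 a)].

Definition model_completion (T' T : theory) : Prop :=
  amalgamation T /\ model_companion T' T.

Definition complete_theory (T : theory) : Prop :=
  (exists M, is_model T M) /\
  (forall p, is_sentence p -> entails T p \/ entails T (FNot p)).

Definition quantifier_elimination (T : theory) : Prop :=
  forall p, exists q, [/\ quantifier_free q,
    {subset free_vars q <= free_vars p} & equiv_mod T p q].

(** * De Morgan algebras *)

Section DeMorganTheory.
Local Notation x := (Var 0).
Local Notation y := (Var 1).
Local Notation z := (Var 2).
Local Open Scope dm_formula_scope.

Inductive DMA : theory :=
  | DMA_joinC : DMA (FAll_n 2 (x + y == y + x))
  | DMA_meetC : DMA (FAll_n 2 (x * y == y * x))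
  | DMA_joinA : DMA (FAll_n 3 (x + (y + z) == (x + y) + z))
  | DMA_meetA : DMA (FAll_n 3 (x * (y * z) == (x * y) * z))
  | DMA_joinK : DMA (FAll_n 2 (x + x * y == x))
  | DMA_meetK : DMA (FAll_n 2 (x * (x + y) == x))
  | DMA_meet_joinr : DMA (FAll_n 3 (x * (y + z) == x * y + x * z))
  | DMA_join0 : DMA (FAll_n 1 (x + 0 == x))
  | DMA_meet1 : DMA (FAll_n 1 (x * 1 == x))
  | DMA_barK : DMA (FAll_n 1 (- (- x) == x))
  | DMA_bar_join : DMA (FAll_n 2 (- (x + y) == - x * - y))
  | DMA_nontrivial : DMA (0 != 1).

Inductive CDMA : theory :=
  | CDMA_DMA p : DMA p -> CDMA p
  | CDMA_complemented : CDMA (FAll 0 (FEx 1 (x * y == 0 /\ x + y == 1))).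

End DeMorganTheory.

(** * The theory ECDA
    The index set {1, ..., n} is 'I_n; the variables y_1, ..., y_n are
    Var 0, ..., Var n.-1, and x, z are Var n, Var n.+1. *)

Definition consistent (n : nat) (sigma : 'S_n) (I1 I2 I3 : {set 'I_n}) : bool :=
  [&& sigma @: I2 == I2, sigma @: I3 == I3 &
      (I1 :&: I2 :&: I3) :&: (sigma @: (I1 :&: I2 :&: I3)) == set0].

Section Formulas.
Variable n : nat.
Local Notation y i := (Var (nat_of_ord i)).
Local Notation x := (Var n).
Local Notation z := (Var n.+1).
Local Open Scope dm_formula_scope.

Definition psi (I : {set 'I_n}) : formula :=
  \big[FAnd/FTrue]_(i in I) (y i * (x * - x) == 0) /\
  \big[FAnd/FTrue]_(i in ~: I) (y i * (x * - x) != 0).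

Definition xi (I : {set 'I_n}) : formula :=
  FEx n.+1 (- x + z == 1 /\ - x * z == 0 /\
    \big[FAnd/FTrue]_(i in I) (y i * (x * z) == 0) /\
    \big[FAnd/FTrue]_(i in ~: I) (y i * (x * z) != 0)).

Definition chi (I : {set 'I_n}) : formula :=
  FEx n.+1 (x + z == 1 /\ x * z == 0 /\
    \big[FAnd/FTrue]_(i in I) (y i * (z * - x) == 0) /\
    \big[FAnd/FTrue]_(i in ~: I) (y i * (z * - x) != 0)).

Definition phi (I1 I2 I3 : {set 'I_n}) : formula := psi I1 /\ xi I2 /\ chi I3.

Definition extension_axiom (sigma : 'S_n) (I1 I2 I3 : {set 'I_n}) : formula :=
  FAll_n n
    ((\big[FAnd/FTrue]_(i < n) (y i != 0) /\
      \big[Join/Zero]_(i < n) y i == 1 /\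
      \big[FAnd/FTrue]_(i < n) \big[FAnd/FTrue]_(j < n | (i != j)%B)
         (y i * y j == 0) /\
      \big[FAnd/FTrue]_(i < n)
         (- y i + y (sigma i) == 1 /\ - y i * y (sigma i) == 0))
     ==> FEx n (phi I1 I2 I3)).

End Formulas.

Inductive ECDA : theory :=
  | ECDA_CDMA p : CDMA p -> ECDA p
  | ECDA_extension (n : nat) (sigma : 'S_n) (I1 I2 I3 : {set 'I_n}) :
      0 < n -> involutive sigma -> consistent sigma I1 I2 I3 ->
      ECDA (extension_axiom sigma I1 I2 I3).

(* Main.v *)
(* A De Morgan algebra M is studied through its points, the homomorphisms from M
   to the four-element algebra; swapping the two coordinates is an involution of
   the space of points. By the prime filter theorem points separate elements and
   extend along embeddings, so the algebra of four-valued functions on the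
   compatible pairs of points amalgamates M1 and M2 over M0. The complemented
   algebra of sets of pairs (point, infinite word over a finite alphabet with a
   free involution) depending on finitely many letters contains M and satisfies the
   extension axioms: a fresh letter realizes any consistent type.

   For quantifier elimination, say that a tuple realizes a cell, i.e. a tuple of
   elements of the four-element algebra, if some point maps the former to the
   latter. Whether a cell is realized is a quantifier-free condition. In a model of
   ECDA every cell is cut out by a complemented element; these elements form a
   partition permuted by the involution, and the extension axiom for it says
   exactly that the set of realized cells can be extended by one coordinate as in
   any other De Morgan algebra. Hence the finite set of cells realized by a tuple
   determines which formulas it satisfies. *)
From mathcomp Require Import all_boot all_fingroup.
From mathcomp Require Import boolp.
From mathcomp Require classical_sets.
Require Import Defs.

Set Implicit Arguments.
Unset Strict Implicit.
Unset Printing Implicit Defensive.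

(** * The De Morgan axioms in algebraic form *)

Record de_morgan_algebra (M : structure) : Prop := DeMorganAlgebra {
  dm_joinC : commutative (@joinS M);
  dm_meetC : commutative (@meetS M);
  dm_joinA : associative (@joinS M);
  dm_meetA : associative (@meetS M);
  dm_joinK : forall a b : M, joinS a (meetS a b) = a;
  dm_meetK : forall a b : M, meetS a (joinS a b) = a;
  dm_meetDr : right_distributive (@meetS M) (@joinS M);
  dm_joinx0 : right_id (zeroS M) (@joinS M);
  dm_meetx1 : right_id (oneS M) (@meetS M);
  dm_barK : involutive (@barS M);
  dm_bar_join : forall a b : M, barS (joinS a b) = meetS (barS a) (barS b);
  dm_0_neq_1 : zeroS M <> oneS M
}.

Lemma is_model_DMA (M : structure) : is_model DMA M <-> de_morgan_algebra M.
Proof.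
split=> [HM | [*] p [] v //=].
pose v0 : nat -> M := fun=> zeroS M.
split.
- exact: HM _ DMA_joinC v0.
- exact: HM _ DMA_meetC v0.
- exact: HM _ DMA_joinA v0.
- exact: HM _ DMA_meetA v0.
- exact: HM _ DMA_joinK v0.
- exact: HM _ DMA_meetK v0.
- exact: HM _ DMA_meet_joinr v0.
- exact: HM _ DMA_join0 v0.
- exact: HM _ DMA_meet1 v0.
- exact: HM _ DMA_barK v0.
- exact: HM _ DMA_bar_join v0.
- exact: HM _ DMA_nontrivial v0.
Qed.

(** * The four-element algebra and its points *)

(* A pair (u, v) records whether an element a lies in a prime filter F, and
   whether [bar a] avoids F. *)
Definition four : structure :=
  @Structure (bool * bool)
    (fun a b => (a.1 || b.1, a.2 || b.2)) (fun a b => (a.1 && b.1, a.2 && b.2))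
    (fun a => (~~ a.2, ~~ a.1)) (false, false) (true, true).

Definition is_hom (M N : structure) (f : M -> N) : Prop :=
  [/\ {morph f : a b / joinS a b >-> joinS a b},
      {morph f : a b / meetS a b >-> meetS a b},
      {morph f : a / barS a >-> barS a} &
      f (zeroS M) = zeroS N /\ f (oneS M) = oneS N].

Lemma embedding_hom (M N : structure) (f : M -> N) : is_embedding f -> is_hom f.
Proof. by case. Qed.

Lemma hom_eval (M N : structure) (f : M -> N) (v : nat -> M) (t : term) :
  is_hom f -> f (eval v t) = eval (f \o v) t.
Proof.
case=> fU fI fN [f0 f1].
by elim: t => //= [s <- t <-|s <- t <-|t <-]; rewrite ?fU ?fI ?fN.
Qed.

Record point (M : structure) := Point {
  point_fun :> M -> four;
  pointP : is_hom point_fun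
}.

Lemma point_join M (g : point M) a b : (g (joinS a b)).1 = (g a).1 || (g b).1.
Proof. by case: g => g [/= ->]. Qed.

Lemma point_meet M (g : point M) a b : (g (meetS a b)).1 = (g a).1 && (g b).1.
Proof. by case: g => g [/= _ ->]. Qed.

Lemma point_bar M (g : point M) a : (g (barS a)).1 = ~~ (g a).2.
Proof. by case: g => g [/= _ _ ->]. Qed.

Lemma point_zero M (g : point M) : g (zeroS M) = (false, false).
Proof. by case: g => g [/= _ _ _ []]. Qed.

Lemma point_one M (g : point M) : g (oneS M) = (true, true).
Proof. by case: g => g [/= _ _ _ []]. Qed.

Lemma point_eval M (g : point M) (v : nat -> M) (t : term) :
  g (eval v t) = eval (g \o v : nat -> four) t.
Proof. exact/hom_eval/pointP. Qed.

Definition swap (a : bool * bool) : bool * bool := (a.2, a.1).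

Lemma swapK : involutive swap. Proof. by case. Qed.

Lemma swap_point_hom M (g : point M) : @is_hom M four (swap \o g).
Proof.
by case: g => g [/= gU gI gN [g0 g1]]; split=> [a b|a b|a|] /=;
  rewrite ?gU ?gI ?gN ?g0 ?g1.
Qed.

(** On prime filters this is the involution sending F to the set of [a] with [barS a] outside F. *)
Definition swap_point M (g : point M) : point M := Point (swap_point_hom g).

Lemma point_inj M (g h : point M) : g =1 h -> g = h.
Proof.
case: g h => g gP [h hP] /= /funext gh.
by rewrite gh in gP *; congr Point; apply: Prop_irrelevance.
Qed.

Lemma swap_pointK M : involutive (@swap_point M).
Proof. by move=> g; apply: point_inj => a /=; rewrite swapK. Qed.

(** * The prime filter theorem *)

Section PrimeFilter.
Variables (M : structure) (HM : de_morgan_algebra M).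
Local Notation "a /\' b" := (@meetS M a b) (at level 40, left associativity).
Local Notation "a \/' b" := (@joinS M a b) (at level 50, left associativity).

Lemma dm_meetxx (a : M) : a /\' a = a.
Proof. by rewrite -{2}(dm_joinK HM a a) (dm_meetK HM). Qed.

Lemma dm_bar0 : barS (zeroS M) = oneS M.
Proof.
rewrite -(dm_barK HM (oneS M)) -(dm_joinx0 HM (barS (oneS M))).
by rewrite (dm_bar_join HM) (dm_barK HM) (dm_meetC HM) (dm_meetx1 HM).
Qed.

Lemma dm_bar_meet (a b : M) : barS (a /\' b) = barS a \/' barS b.
Proof.
by rewrite -{1}(dm_barK HM a) -{1}(dm_barK HM b) -(dm_bar_join HM) (dm_barK HM).
Qed.

Lemma point_of_prime_filter (G : M -> Prop) :
  G (oneS M) -> ~ G (zeroS M) ->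
  (forall a b, G (a /\' b) <-> G a /\ G b) ->
  (forall a b, G (a \/' b) <-> G a \/ G b) ->
  exists g : point M, forall a, (g a).1 = `[< G a >].
Proof.
move=> G1 G0 GI GU.
have eI a b : `[< G (a /\' b) >] = `[< G a >] && `[< G b >].
  by rewrite -asbool_and; apply/asbool_equiv_eq.
have eU a b : `[< G (a \/' b) >] = `[< G a >] || `[< G b >].
  by rewrite -asbool_or; apply/asbool_equiv_eq.
have e1 : `[< G (oneS M) >] by apply/asboolP.
have e0 : `[< G (zeroS M) >] = false by apply/asboolP.
suff gP : @is_hom M four (fun a => (`[< G a >], ~~ `[< G (barS a) >])).
  by exists (Point gP).
split=> [a b|a b|a|] /=.
- by rewrite (dm_bar_join HM) eI eU negb_and.
- by rewrite dm_bar_meet eI eU negb_or.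
- by rewrite (dm_barK HM) negbK.
- by rewrite -{2}dm_bar0 (dm_barK HM) dm_bar0 e0 e1.
Qed.

(** A set maximal, by Zorn's lemma, among the meet-closed ones that contain [A] and miss the ideal
    [J] is a prime filter. *)
Lemma prime_filter (A J : M -> Prop) :
  A (oneS M) -> (forall a b, A a -> A b -> A (a /\' b)) ->
  J (zeroS M) -> (forall a b, J a -> J b -> J (a \/' b)) ->
  (forall a b, J b -> a /\' b = a -> J a) ->
  (forall a, A a -> ~ J a) ->
  exists g : point M,
    (forall a, A a -> (g a).1) /\ (forall a, J a -> (g a).1 = false).
Proof.
move=> A1 AI J0 JU Jdown AJ.
have meet_lel a b : a /\' b /\' a = a /\' b.
  by rewrite (dm_meetC HM) (dm_meetA HM) dm_meetxx.
have meet_ler a b : a /\' b /\' b = a /\' b.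
  by rewrite -(dm_meetA HM) dm_meetxx.
have meet_le2 p q a : p /\' q = p -> p /\' a /\' (q /\' a) = p /\' a.
  move=> pq; rewrite -(dm_meetA HM) (dm_meetA HM a) (dm_meetC HM a).
  by rewrite -(dm_meetA HM q) dm_meetxx (dm_meetA HM) pq.
(* Containment of [A] is asked of nonempty [G] only, so that the union of the empty chain
   qualifies. *)
pose P (G : M -> Prop) := [/\ forall x a, G x -> A a -> G a,
  forall x y, G x -> G y -> G (x /\' y) & forall x, G x -> ~ J x].
have [|G [[GA GI GJ] Gmax]] := @classical_sets.Zorn_bigcup M P.
  move=> F FP Ftot; split=> [x a [X FX Xx] Aa|x y [X FX Xx] [Y FY Yy]|x [X FX Xx]].
  - by exists X => //; have [XA _ _] := FP X FX; apply: (XA x).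
  - have [XY|YX] := Ftot X Y FX FY.
    + exists Y => //; have [_ YI _] := FP Y FY; exact: YI _ _ (XY _ Xx) Yy.
    + exists X => //; have [_ XI _] := FP X FX; exact: XI _ _ Xx (YX _ Yy).
  - by have [_ _] := FP X FX; apply.
(* If [G] missed an element of [A] it would be empty, and [A] itself would be larger. *)
have {GA} AG a : A a -> G a.
  move=> Aa; apply: contrapT => nGa; apply: (Gmax A); last by split=> // ? ? ? /AI.
  by split=> [x Gx|/(_ a Aa)//]; case: nGa; apply: GA Gx Aa.
have G1 := AG _ A1.
have notG c : ~ G c -> exists2 x, G x & J (x /\' c).
  move=> nGc; apply: contrapT => nx.
  (* [G'] is generated by [G] and [c], hence strictly larger than [G]; by maximality it meets
     [J]. *)
  pose G' x := G x \/ exists2 y, G y & x = y /\' c.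
  apply: (Gmax G'); last first.
    split=> [x a _ /AG Ga|x y|x]; first by left.
      case=> [Gx|[x' Gx ->]] [Gy|[y' Gy ->]].
      - by left; apply: GI.
      - right; exists (x /\' y'); [exact: GI | exact: (dm_meetA HM)].
      - right; exists (x' /\' y); first exact: GI.
        by rewrite -!(dm_meetA HM) (dm_meetC HM c).
      - right; exists (x' /\' y'); first exact: GI.
        by rewrite -!(dm_meetA HM) (dm_meetA HM c) (dm_meetC HM c) meet_ler.
    by case=> [|[y Gy ->] Jy]; [exact: GJ | apply: nx; exists y].
  split=> [x Gx|/(_ c) G'c]; first by left.
  apply/nGc/G'c; right; exists (oneS M) => //.
  by rewrite (dm_meetC HM) (dm_meetx1 HM).
have Gup a b : G a -> a /\' b = a -> G b.
  move=> Ga ab; apply: contrapT => /notG [x Gx Jx].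
  apply: (GJ (x /\' a)); first exact: GI.
  by apply: Jdown Jx _; rewrite (dm_meetA HM) meet_lel -(dm_meetA HM) ab.
have GIE a b : G (a /\' b) <-> G a /\ G b.
  by split=> [Gab|[]]; [split; apply: Gup Gab _; rewrite ?meet_ler ?meet_lel | exact: GI].
have GUE a b : G (a \/' b) <-> G a \/ G b.
  split=> [Gab|[] Ga]; last 2 first.
  - exact: Gup Ga (dm_meetK HM _ _).
  - by apply: Gup Ga _; rewrite (dm_joinC HM) (dm_meetK HM).
  apply: contrapT => /not_orP [/notG [x Gx Jx] /notG [y Gy Jy]].
  apply: (GJ (x /\' y /\' (a \/' b))); first by apply: (GI) => //; apply: GI.
  rewrite (dm_meetDr HM); apply: JU.
    by apply: Jdown Jx _; apply: meet_le2.
  by apply: Jdown Jy _; apply: meet_le2.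
have [|g gE] := point_of_prime_filter G1 _ GIE GUE; first by move/GJ.
by exists g; split=> a Ha; rewrite gE; apply/asboolP; [exact: AG | move/GJ].
Qed.

Lemma dm_meet0 (a : M) : zeroS M /\' a = zeroS M.
Proof. by rewrite -{1}(dm_joinx0 HM a) (dm_joinC HM) (dm_meetK HM). Qed.

(** Otherwise the filter above [a] misses the ideal below [b], and a point separates them. *)
Lemma point_le (a b : M) :
  (forall g : point M, (g a).1 -> (g b).1) -> a /\' b = a.
Proof.
move=> gab; apply: contrapT => nab.
have [|x y ax ay||x y xb yb|x y yb xy|x ax xb|g [gA gJ]] :=
  @prime_filter (fun x => a /\' x = a) (fun x => x /\' b = x).
- exact: dm_meetx1.
- by rewrite (dm_meetA HM) ax.
- exact: dm_meet0.
- by rewrite (dm_meetC HM) (dm_meetDr HM) !(dm_meetC HM b) xb yb.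
- by rewrite -xy -(dm_meetA HM) yb.
- by apply: nab; rewrite -ax -(dm_meetA HM) xb.
- by have := gab g (gA a (dm_meetxx a)); rewrite gJ ?dm_meetxx.
Qed.

Lemma eq_point (a b : M) : (forall g : point M, (g a).1 = (g b).1) -> a = b.
Proof.
move=> gab; rewrite -[LHS](@point_le a b) => [|g]; last by rewrite gab.
by rewrite (dm_meetC HM) point_le // => g; rewrite gab.
Qed.

Lemma eq_zero (a : M) : a = zeroS M <-> forall g : point M, (g a).1 = false.
Proof.
split=> [-> g|a0]; first by rewrite point_zero.
by apply: eq_point => g; rewrite a0 point_zero.
Qed.

Lemma neq_zero (a : M) : a <> zeroS M <-> exists g : point M, (g a).1.
Proof.
split=> [a0|[g ga] /eq_zero/(_ g)]; last by rewrite ga.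
apply: contrapT => /forallNP ng; apply/a0/eq_zero => g; exact/negbTE/negP.
Qed.

Lemma exists_point : inhabited (point M).
Proof. by have [g _] := (neq_zero (oneS M)).1 (nesym (dm_0_neq_1 HM)). Qed.

End PrimeFilter.

(** The image of the prime filter of [h] is disjoint from the ideal generated by the image of its
    complement, because [f] is injective; a point separating the two extends [h]. *)
Lemma point_extension (M N : structure) (f : M -> N) (h : point M) :
  de_morgan_algebra M -> de_morgan_algebra N -> is_embedding f ->
  exists g : point N, forall a, g (f a) = h a.
Proof.
move=> HM HN [finj fU fI fN [f0 f1]].
have [||||||g [gA gJ]] := prime_filter HN (A := fun x => exists2 m, (h m).1 & x = f m)
   (J := fun x => exists2 m, (h m).1 = false & meetS x (f m) = x).
- by exists (oneS M); rewrite ?point_one.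
- move=> _ _ [a ha ->] [b hb ->]; exists (meetS a b); last by rewrite fI.
  by rewrite point_meet ha.
- by exists (zeroS M); rewrite ?point_zero // (dm_meet0 HN).
- move=> x y [a ha xa] [b hb yb]; exists (joinS a b); first by rewrite point_join ha.
  rewrite (dm_meetC HN) (dm_meetDr HN) !(dm_meetC HN (f _)) fU.
  rewrite -{1}xa -(dm_meetA HN) (dm_meetK HN) xa.
  by rewrite -{1}yb -(dm_meetA HN) (dm_joinC HN (f a)) (dm_meetK HN) yb.
- by move=> x y [a ha ya] xy; exists a => //; rewrite -xy -(dm_meetA HN) ya.
- move=> _ [a ha ->] [b hb]; rewrite -fI => /finj ab.
  by move: ha; rewrite -ab point_meet hb andbF.
- have g1 a : (g (f a)).1 = (h a).1.
    case ha: (h a).1; first by apply: gA; exists a.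
    by apply: gJ; exists a; rewrite ?(dm_meetxx HN).
  exists g => a; rewrite [LHS]surjective_pairing [RHS]surjective_pairing g1.
  by rewrite -[(g _).2]negbK -[(h _).2]negbK -!point_bar -fN g1.
Qed.

(** * Powers of the four-element algebra and amalgamation *)

Lemma four_de_morgan : de_morgan_algebra four.
Proof. by split=> //; do ?[case | move=> ?]. Qed.

Definition power (X : Type) : structure :=
  @Structure (X -> four)
    (fun a b x => joinS (a x) (b x)) (fun a b x => meetS (a x) (b x))
    (fun a x => barS (a x)) (fun=> zeroS four) (fun=> oneS four).

Lemma power_de_morgan (X : Type) : inhabited X -> de_morgan_algebra (power X).
Proof.
move=> [x0]; case: four_de_morgan => jC mC jA mA jK mK mD j0 m1 bK bj n01.
split; last by move/(congr1 (@^~ x0)).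
all: repeat intro; apply: funext => ?.
- exact: jC. - exact: mC. - exact: jA. - exact: mA. - exact: jK. - exact: mK.
- exact: mD. - exact: j0. - exact: m1. - exact: bK. - exact: bj.
Qed.

Lemma comp_hom (M N L : structure) (f : M -> N) (g : N -> L) :
  is_hom f -> is_hom g -> is_hom (g \o f).
Proof.
case=> fU fI fN [f0 f1] [gU gI gN [g0 g1]].
by split=> [a b|a b|a|] /=; rewrite ?fU ?fI ?fN ?f0 ?f1.
Qed.

Definition comp_point (M N : structure) (f : M -> N) (fP : is_hom f)
  (g : point N) : point M := Point (comp_hom fP (pointP g)).

Lemma power_embedding (M : structure) (X : Type) (e : X -> point M) :
  de_morgan_algebra M -> (forall h, exists x, e x = h) ->
  @is_embedding M (power X) (fun a x => e x a).
Proof.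
move=> HM esurj; split; [|move=> a b|move=> a b|move=> a|split]; last 5 first.
1-5: by apply: funext => x; case: (pointP (e x)) => hU hI hN [h0 h1].
move=> a b ab; apply: (eq_point HM) => h; have [x <-] := esurj h.
by have /= -> := congr1 (@^~ x) ab.
Qed.

(* Every point h of M1 extends to a compatible pair (h, g), because the trace of
   h on M0 extends to M2; hence the compatible pairs separate M1, and M2. *)
Lemma DMA_amalgamation : amalgamation DMA.
Proof.
move=> M0 M1 M2 f1 f2 /is_model_DMA H0 /is_model_DMA H1 /is_model_DMA H2 e1 e2.
pose R (p : point M1 * point M2) := forall a, p.1 (f1 a) = p.2 (f2 a).
have ext1 (h : point M1) : exists p : {p | R p}, (sval p).1 = h.
  have [g gh] := point_extension (comp_point (embedding_hom e1) h) H0 H2 e2.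
  have ph : R (h, g) by move=> a; rewrite /= gh.
  by exists (exist R (h, g) ph).
have ext2 (h : point M2) : exists p : {p | R p}, (sval p).2 = h.
  have [g gh] := point_extension (comp_point (embedding_hom e2) h) H0 H1 e1.
  have ph : R (g, h) by move=> a; rewrite /= gh.
  by exists (exist R (g, h) ph).
pose p1 (p : {p | R p}) := (sval p).1; pose p2 (p : {p | R p}) := (sval p).2.
exists (power {p | R p}), (fun a p => p1 p a), (fun a p => p2 p a); split.
- have [h] := exists_point H1; have [p _] := ext1 h.
  exact/is_model_DMA/power_de_morgan.
- exact: power_embedding.
- exact: power_embedding.
- by move=> a; apply: funext => p; apply: (svalP p).
Qed.
(** * Semantics of the axioms of ECDA *)

Lemma sat_big_and (M : structure) (v : nat -> M) (T : finType) (P : pred T)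
    (F : T -> formula) :
  sat v (\big[FAnd/FTrue]_(i | P i) F i) <-> forall i, P i -> sat v (F i).
Proof.
suff H r : sat v (\big[FAnd/FTrue]_(i <- r | P i) F i) <->
    forall i, i \in r -> P i -> sat v (F i).
  by rewrite H; split=> Hr i *; apply: Hr => //; apply: mem_index_enum.
elim: r => [|i r IHr]; first by rewrite big_nil; split=> [|_ []].
have Hi : (forall j, j \in i :: r -> P j -> sat v (F j)) <->
    (P i -> sat v (F i)) /\ (forall j, j \in r -> P j -> sat v (F j)).
  split=> [H|[H1 H2] j]; first by split=> [|j jr]; apply: H; rewrite inE ?eqxx ?jr ?orbT.
  by rewrite inE => /predU1P [->|/H2].
rewrite big_cons Hi -IHr; by case: (P i) => /=; intuition.
Qed.

Lemma valid_FAll_n (M : structure) (n : nat) (p : formula) :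
  valid_in M (FAll_n n p) <-> valid_in M p.
Proof.
rewrite /FAll_n; elim: (iota 0 n) => //= i s <-.
split=> [H v|H v a]; last exact: H.
suff <- : update v i (v i) = v by apply: H.
by apply: funext => j; rewrite /update; case: eqP => [->|].
Qed.

(** In the applications [v] is [u] updated at the variables x and z, whose indices are at least
    [n]. *)
Lemma sat_vanishing (M : structure) (n : nat) (u v : nat -> M) (t : term)
    (I : {set 'I_n}) :
  (forall i : 'I_n, v i = u i) ->
  sat v (FAnd
    (\big[FAnd/FTrue]_(i in I) FEq (Meet (Var i) t) Zero)
    (\big[FAnd/FTrue]_(i in ~: I) FNeq (Meet (Var i) t) Zero)) <->
  forall i : 'I_n, meetS (u i) (eval v t) = zeroS M <-> i \in I.
Proof.
move=> uv; rewrite /= !sat_big_and /=; split=> [[HI HIC] i|H].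
  rewrite -uv; split=> [i0|/HI//].
  by apply: contrapT => /negP niI; apply: (HIC i); rewrite ?inE.
split=> i; rewrite ?inE uv => iI; first exact/H.
by move/H; apply/negP.
Qed.

Lemma update_ord (M : Type) (n m : nat) (u : nat -> M) (a : M) (i : 'I_n) :
  n <= m -> update u m a i = u i.
Proof. by move=> nm; rewrite /update ltn_eqF // (leq_trans _ nm). Qed.

Lemma eval_big_join (M : structure) (v : nat -> M) (n : nat) :
  eval v (\big[Join/Zero]_(i < n) Var i) = \big[@joinS M/zeroS M]_(i < n) v i.
Proof. exact: big_morph. Qed.

Lemma valid_extension (M : structure) (n : nat) (sigma : 'S_n)
    (I1 I2 I3 : {set 'I_n}) :
  valid_in M (extension_axiom sigma I1 I2 I3) <->
  forall v : nat -> M,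
    (forall i : 'I_n, v i <> zeroS M) ->
    \big[@joinS M/zeroS M]_(i < n) v i = oneS M ->
    (forall i j : 'I_n, i != j -> meetS (v i) (v j) = zeroS M) ->
    (forall i : 'I_n, joinS (barS (v i)) (v (sigma i)) = oneS M /\
      meetS (barS (v i)) (v (sigma i)) = zeroS M) ->
  exists b,
    [/\ forall i : 'I_n, meetS (v i) (meetS b (barS b)) = zeroS M <-> i \in I1,
        exists z, [/\ joinS (barS b) z = oneS M, meetS (barS b) z = zeroS M &
          forall i : 'I_n, meetS (v i) (meetS b z) = zeroS M <-> i \in I2] &
        exists z, [/\ joinS b z = oneS M, meetS b z = zeroS M &
          forall i : 'I_n, meetS (v i) (meetS z (barS b)) = zeroS M <-> i \in I3]].
Proof.
rewrite /extension_axiom valid_FAll_n.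
have allE (P Q : (nat -> M) -> Prop) :
    (forall v, P v <-> Q v) -> (forall v, P v) <-> (forall v, Q v).
  by move=> PQ; split=> H v; apply/PQ.
have premE (p q r s p' r' s' c c' : Prop) :
   (p <-> p') -> (r <-> r') -> (s <-> s') -> (c <-> c') ->
   ((p /\ q /\ r /\ s -> c) <-> (p' -> q -> r' -> s' -> c')) by tauto.
have andE3 (p q r p' q' r' : Prop) : (p <-> p') -> (q <-> q') -> (r <-> r') ->
  (p /\ q /\ r <-> [/\ p', q' & r']) by move=> [? ?] [? ?] [? ?]; split=> -[]; intuition.
have exE (P Q : M -> Prop) : (forall a, P a <-> Q a) -> (exists a, P a) <-> (exists a, Q a).
  by move=> PQ; split=> -[a /PQ]; exists a.
have uE (v : nat -> M) a (i : 'I_n) : update v n a i = v i by exact: update_ord.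
have uuE (v : nat -> M) a z (i : 'I_n) : update (update v n a) n.+1 z i = v i.
  by rewrite !update_ord.
have un (v : nat -> M) a : update v n a n = a by rewrite /update eqxx.
have uun (v : nat -> M) a z : update (update v n a) n.+1 z n = a.
  by rewrite /update ltn_eqF // eqxx.
have uunS (v : nat -> M) a z : update (update v n a) n.+1 z n.+1 = z.
  by rewrite /update eqxx.
apply: allE => v; rewrite -eval_big_join /=; apply: premE.
- by rewrite sat_big_and; split=> H i; [exact: (H i isT) | move=> _; exact: H].
- rewrite sat_big_and; split=> [H i j ij|H i _].
    by have /sat_big_and/(_ j ij) := H i isT.
  by apply/sat_big_and => j; exact: H.
- by rewrite sat_big_and; split=> H i; [exact: (H i isT) | move=> _; exact: H].
apply: (exE) => b; apply: (andE3).
- have /= -> := @sat_vanishing M n v (update v n b)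
    (Meet (Var n) (Bar (Var n))) I1 (uE v b).
  by rewrite un.
- rewrite /xi /=; apply: (exE) => z; apply: (andE3).
  + by rewrite uun uunS.
  + by rewrite uun uunS.
  + have /= -> := @sat_vanishing M n v (update (update v n b) n.+1 z)
      (Meet (Var n) (Var n.+1)) I2 (uuE v b z).
    by rewrite uun uunS.
- rewrite /chi /=; apply: (exE) => z; apply: (andE3).
  + by rewrite uun uunS.
  + by rewrite uun uunS.
  + have /= -> := @sat_vanishing M n v (update (update v n b) n.+1 z)
      (Meet (Var n.+1) (Bar (Var n))) I3 (uuE v b z).
    by rewrite uun uunS.
Qed.

Lemma is_model_ECDA (M : structure) :
  is_model ECDA M <->
  [/\ de_morgan_algebra M,
      forall a : M, exists b, meetS a b = zeroS M /\ joinS a b = oneS M &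
      forall n (sigma : 'S_n) (I1 I2 I3 : {set 'I_n}), 0 < n ->
        involutive sigma -> consistent sigma I1 I2 I3 ->
        valid_in M (extension_axiom sigma I1 I2 I3)].
Proof.
split=> [HM|[/is_model_DMA HM Mcompl Mext] p [_ [p' /HM//|]|]]; first split.
- by apply/is_model_DMA => p pP; apply: HM; do 2!constructor.
- move=> a; exact: HM _ (ECDA_CDMA CDMA_complemented) (fun=> a) a.
- by move=> n sigma I1 I2 I3 n0 sK sI; apply: HM; constructor.
- by move=> v a; apply: Mcompl.
- exact: Mext.
Qed.

Lemma mem_involutive_imset (T : finType) (s : {perm T}) (A : {set T}) i :
  involutive s -> (i \in s @: A) = (s i \in A).
Proof. by move=> sK; rewrite -{1}(sK i) mem_imset //; apply: perm_inj. Qed.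

(** As [sigma] preserves [I2] and [I3], disjointness only has to test [sigma i] against [I1]. *)
Lemma consistentP n (sigma : 'S_n) (I1 I2 I3 : {set 'I_n}) : involutive sigma ->
  reflect [/\ forall i, (sigma i \in I2) = (i \in I2),
              forall i, (sigma i \in I3) = (i \in I3) &
              forall i, ~~ [&& i \in I1, i \in I2, i \in I3 & sigma i \in I1]]
          (consistent sigma I1 I2 I3).
Proof.
move=> sK; apply: (iffP and3P) => [[/eqP s2 /eqP s3 /eqP/setP s0]|[s2 s3 s0]].
  have s2E i : (sigma i \in I2) = (i \in I2) by rewrite -{2}s2 mem_involutive_imset.
  have s3E i : (sigma i \in I3) = (i \in I3) by rewrite -{2}s3 mem_involutive_imset.
  split=> // i; have := s0 i; rewrite !inE mem_involutive_imset // !inE s2E s3E.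
  by do 4!case: (_ \in _).
split; apply/eqP/setP => i; rewrite ?inE mem_involutive_imset // ?inE s2 s3.
by apply: contraNF (s0 i); do 4!case: (_ \in _).
Qed.

(** * A model of ECDA containing a given De Morgan algebra *)

(* The third bit of a letter makes [flip] act freely, so that every consistent
   type, even on a part fixed by the involution, is realized by some letter. *)
Definition letter : finType := (bool * bool * bool)%type.
Definition flip (s : letter) : letter := (s.1, ~~ s.2).

Lemma flipK : involutive flip. Proof. by case=> s b; rewrite /flip /= negbK. Qed.

(** [f i s] prescribes, on block [i] at letter [s], whether a word and its mirror image belong to
    the element to be built. Omitting (true, false), (true, true) or (false, false) is what psi, xi
    and chi express. *)
Lemma realize_consistent n (sigma : 'S_n) (I1 I2 I3 : {set 'I_n}) :
  involutive sigma -> consistent sigma I1 I2 I3 ->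
  exists f : 'I_n -> letter -> bool * bool,
    [/\ forall i s, f (sigma i) (flip s) = swap (f i s),
        forall i, i \in I1 <-> forall s, f i s <> (true, false),
        forall i, i \in I2 <-> forall s, f i s <> (true, true) &
        forall i, i \in I3 <-> forall s, f i s <> (false, false)].
Proof.
move=> sK /(consistentP _ _ _ sK) [s2 s3 s0].
pose ok i (t : bool * bool) := match t with
  | (true, false) => i \notin I1 | (true, true) => i \notin I2
  | (false, false) => i \notin I3 | (false, true) => sigma i \notin I1 end.
have ok_swap i t : ok (sigma i) (swap t) = ok i t.
  by case: t => [[] []]; rewrite /= ?sK ?s2 ?s3.
(* Consistency says exactly that every block allows some value. *)
have /choice [d dP] i : exists t, ok i t.
  have := s0 i; rewrite !negb_and => /or4P [] ?; [exists (true, false)|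
    exists (true, true)|exists (false, false)|exists (false, true)]; by [].
pose g i t := if ok i t then t else d i.
have gP i t : ok i (g i t) by rewrite /g; case: ifP.
(* The third bit selects one letter from each orbit of [flip]: there every allowed value occurs, and
   equivariance dictates the other half. *)
pose f i (s : letter) := if s.2 then swap (g (sigma i) s.1) else g i s.1.
have fP i s : ok i (f i s).
  by rewrite /f; case: ifP => // _; rewrite -[i in ok i]sK ok_swap.
have fE i t : ok i t -> f i (t, false) = t by rewrite /f /g /= => ->.
have fI i t : ~~ ok i t <-> forall s, f i s <> t.
  split=> [nt s ft|ft]; first by have := fP i s; rewrite ft (negPf nt).
  by apply/negP => /fE /ft.
exists f; split=> [i [t []]|i|i|i]; rewrite -?fI ?negbK //.
- by rewrite /f /= swapK.
- by rewrite /f /= sK.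
Qed.

(** * The algebra of sets of words depending on finitely many letters *)

Section GenericExtension.
Variables (Y : Type) (h : Y -> Y).
Hypothesis hK : involutive h.

Definition word : Type := Y * (nat -> letter).
Definition word_inv (w : word) : word := (h w.1, flip \o w.2).

Lemma word_invK : involutive word_inv.
Proof.
move=> [y s]; rewrite /word_inv /= hK; congr pair.
by apply: funext => k /=; rewrite flipK.
Qed.

Definition depends_below (m : nat) (U : word -> bool) : Prop :=
  forall y s t, (forall k, k < m -> s k = t k) -> U (y, s) = U (y, t).

Definition clopen : Type := {U : word -> bool | exists m, depends_below m U}.
Local Notation "U @ w" := (sval U w) (at level 10, no associativity).

Lemma clopen_eq (U V : clopen) : sval U =1 sval V -> U = V.
Proof. by case: U V => U HU [V HV] /funext; apply: eq_exist. Qed.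

Lemma depends_le m m' U : m <= m' -> depends_below m U -> depends_below m' U.
Proof. by move=> mm Um y s t st; apply: Um => k km; apply/st/(leq_trans km). Qed.

Lemma clopen2_subproof (op : bool -> bool -> bool) (U V : clopen) :
  exists m, depends_below m (fun w => op (U @ w) (V @ w)).
Proof.
case: U V => [U [m Um]] [V [m' Vm]]; exists (maxn m m') => y s t st /=.
by congr op; [apply: (depends_le _ Um) st | apply: (depends_le _ Vm) st];
  rewrite ?leq_maxl ?leq_maxr.
Qed.

Definition clopen2 op U V : clopen := exist _ _ (clopen2_subproof op U V).

Lemma clopen_inv_subproof (U : clopen) :
  exists m, depends_below m (fun w => U @ (word_inv w)).
Proof.
case: U => [U [m Um]]; exists m => y s t st /=.
by apply: Um => k km; rewrite /= st.
Qed.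

Definition clopen_inv U : clopen := exist _ _ (clopen_inv_subproof U).

Definition clopen_const (b : bool) : clopen :=
  exist _ (fun=> b) (ex_intro _ 0 (fun _ _ _ _ => erefl)).

Definition clopen_neg (U : clopen) : clopen := clopen2 (fun b _ => ~~ b) U U.

(** [barS] is the complement of the preimage under [word_inv], the De Morgan negation dual to a
    space with an involution. *)
Definition generic : structure :=
  @Structure clopen (clopen2 orb) (clopen2 andb)
    (fun U => clopen_neg (clopen_inv U)) (clopen_const false) (clopen_const true).

Hypothesis Y_inhabited : inhabited Y.

Lemma generic_de_morgan : de_morgan_algebra generic.
Proof.
have [y0] := Y_inhabited; split=> [U V|U V|U V W|U V W|U V|U V|U V W|U|U|U|U V|];
  last by move/(congr1 (fun U : clopen => U @ (y0, fun=> (true, true, true)))).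
all: apply: clopen_eq => w /=.
- exact: orbC.
- exact: andbC.
- exact: orbA.
- exact: andbA.
- by case: (U @ w).
- by case: (U @ w).
- exact: andb_orr.
- exact: orbF.
- exact: andbT.
- by rewrite word_invK negbK.
- exact: negb_or.
Qed.

Lemma generic_complemented (U : generic) :
  exists V, meetS U V = zeroS generic /\ joinS U V = oneS generic.
Proof.
exists (clopen_neg U); split; apply: clopen_eq => w; [exact: andbN | exact: orbN].
Qed.

Lemma generic_neq0 (U : generic) : U <> zeroS generic -> exists w, U @ w.
Proof.
move=> U0; apply: contrapT => /forallNP nU; apply: U0; apply: clopen_eq => w.
exact/negbTE/negP.
Qed.

(** A letter that no [v i] reads is independent of the partition, so it can choose freely among the
    values of [f]. *)
Lemma generic_extension n (sigma : 'S_n) (I1 I2 I3 : {set 'I_n}) :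
  involutive sigma -> consistent sigma I1 I2 I3 ->
  valid_in generic (extension_axiom sigma I1 I2 I3).
Proof.
move=> sK sI; apply/valid_extension => v v0 vU vI vs.
have [f [fs f1 f2 f3]] := realize_consistent sK sI.
(* The premise makes [v (sigma i)] the complement of [barS (v i)]: the involution carries block [i]
   to block [sigma i]. *)
have v_inv (i : 'I_n) w : v (sigma i) @ (word_inv w) = v i @ w.
  have [/(congr1 (fun U : generic => U @ (word_inv w))) /= + 
    /(congr1 (fun U : generic => U @ (word_inv w))) /=] := vs i.
  by rewrite word_invK; case: (v i @ w); case: (_ @ _).
have v_uniq (i j : 'I_n) w : v i @ w -> v j @ w -> i = j.
  move=> vi vj; apply/eqP; apply: contraTT isT => /vI.
  by move/(congr1 (fun U : generic => U @ w)) => /=; rewrite vi vj.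
have [m vm] : exists m, forall i : 'I_n, depends_below m (sval (v i)).
  have /choice [d dP] (i : 'I_n) : exists m, depends_below m (sval (v i)).
    exact: (svalP (v i : clopen)).
  by exists (\max_i d i) => i; apply: depends_le (dP i); apply: leq_bigmax.
(* Position [m] holds the fresh letter. By equivariance of [f], its second coordinate decides
   membership of the mirror image. *)
pose b w := [exists i : 'I_n, v i @ w && (f i (w.2 m)).1].
have bP : exists m, depends_below m b.
  exists m.+1 => y s t st; apply: eq_existsb => i /=; rewrite st //.
  by congr andb; apply: vm => k km; apply/st/ltnW.
have bE (i : 'I_n) w : v i @ w -> b w = (f i (w.2 m)).1.
  move=> vi; apply/existsP/idP => [[j /andP [/(v_uniq _ _ _ vi) <-]]//|fi].
  by exists i; rewrite vi.
have b_invE (i : 'I_n) w : v i @ w -> b (word_inv w) = (f i (w.2 m)).2.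
  by move=> vi; rewrite (bE (sigma i)) ?v_inv //= fs.
(* Changing the letter at [m] does not leave block [i]. *)
have real (i : 'I_n) s : exists w, v i @ w /\ f i (w.2 m) = f i s.
  have [[y t] vt] := generic_neq0 (v0 i).
  exists (y, fun k => if k == m then s else t k); rewrite /= eqxx; split=> //.
  by apply: etrans vt; apply: vm => k /ltn_eqF ->.
pose B : generic := exist _ b bP.
have vanish (c : generic) (t : bool * bool) (i : 'I_n) :
    (forall w, v i @ w -> c @ w = (f i (w.2 m) == t)) ->
    meetS (v i) c = zeroS generic <-> forall s, f i s <> t.
  move=> cE; split=> [ci s fs_t|ft].
    have [w [vw fw]] := real i s.
    have := congr1 (fun U : generic => U @ w) ci.
    by rewrite /= cE // vw fw fs_t eqxx.
  apply: clopen_eq => w /=; case vw: (v i @ w) => //=.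
  by rewrite cE //; apply/eqP/ft.
exists B; split=> [i||].
- rewrite f1; apply: vanish => w vw /=.
  by rewrite (bE i) // (b_invE i) //; case: (f i _) => [[] []].
- exists (clopen_inv B); split=> [||i]; try apply: clopen_eq => w /=.
  + exact: orNb.
  + exact: andNb.
  + rewrite f2; apply: vanish => w vw /=.
    by rewrite (bE i) // (b_invE i) //; case: (f i _) => [[] []].
- exists (clopen_neg B); split=> [||i]; try apply: clopen_eq => w /=.
  + exact: orbN.
  + exact: andbN.
  + rewrite f3; apply: vanish => w vw /=.
    by rewrite (bE i) // (b_invE i) //; case: (f i _) => [[] []].
Qed.

Lemma generic_ECDA : is_model ECDA generic.
Proof.
apply/is_model_ECDA; split=> [||n sigma I1 I2 I3 _].
- exact: generic_de_morgan.
- exact: generic_complemented.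
- exact: generic_extension.
Qed.

End GenericExtension.

(** An element goes to the set of words whose point has it in its filter, reading no letter; [barS]
    is respected because the involution acts on points by [swap_point]. *)
Lemma DMA_embeds_ECDA (M : structure) :
  is_model DMA M -> exists2 N, is_model ECDA N & embeds M N.
Proof.
move=> /is_model_DMA HM; exists (generic (@swap_point M)).
  exact/generic_ECDA/exists_point/HM/swap_pointK.
have dep (a : M) : exists m, depends_below m (fun w : word (point M) => (w.1 a).1).
  by exists 0.
pose e a : clopen (point M) := exist _ _ (dep a).
exists e; split; [|move=> a b|move=> a b|move=> a|split].
- move=> a b /(congr1 sval) /= ab; apply: (eq_point HM) => g.
  exact: (congr1 (@^~ (g, fun=> (true, true, true))) ab).
- by apply: clopen_eq => -[g s] /=; rewrite point_join.
- by apply: clopen_eq => -[g s] /=; rewrite point_meet.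
- by apply: clopen_eq => -[g s] /=; rewrite point_bar.
- by apply: clopen_eq => -[g s] /=; rewrite point_zero.
- by apply: clopen_eq => -[g s] /=; rewrite point_one.
Qed.

(** * Quantifier elimination *)

Definition realizes (M : structure) (V : seq nat) (v : nat -> M)
  (c : seq (bool * bool)) : Prop := exists g : point M, map (g \o v) V = c.

Definition sim (M N : structure) (V : seq nat) (v : nat -> M) (w : nat -> N) :=
  forall c, realizes V v c <-> realizes V w c.

Lemma sim_sym (M N : structure) V (v : nat -> M) (w : nat -> N) :
  sim V v w -> sim V w v.
Proof. by move=> vw c; split=> /vw. Qed.

Lemma sim_subset (M N : structure) (V W : seq nat) (v : nat -> M) (w : nat -> N) :
  {subset W <= V} -> sim V v w -> sim W v w.
Proof.
suff H (A B : structure) (a : nat -> A) (b : nat -> B) c :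
    {subset W <= V} -> sim V a b -> realizes W a c -> realizes W b c.
  by move=> WV vw c; split; apply: H => //; apply: sim_sym.
move=> WV ab [g <-]; have [h /eq_in_map hg] := (ab _).1 (ex_intro _ g erefl).
by exists h; apply/eq_in_map => i /WV; apply: hg.
Qed.

Lemma eq_in_eval (M : structure) (u v : nat -> M) (t : term) :
  {in term_vars t, u =1 v} -> eval u t = eval v t.
Proof.
elim: t => //= [i|s IHs t IHt|s IHs t IHt|t IHt] uv; first by apply: uv; rewrite inE.
- by rewrite IHs ?IHt // => i it; apply: uv; rewrite mem_cat it ?orbT.
- by rewrite IHs ?IHt // => i it; apply: uv; rewrite mem_cat it ?orbT.
- by rewrite IHt.
Qed.

(* The formula [cell V c] expresses that some point maps V to c, that is, by the
   prime filter theorem, that [cell_low V c] is not below [cell_high V c]. *)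
Fixpoint cell_low (V : seq nat) (c : seq (bool * bool)) : term :=
  match V, c with
  | i :: V, p :: c => Meet (Meet (if p.1 then Var i else One)
                                 (if p.2 then One else Bar (Var i))) (cell_low V c)
  | _, _ => One
  end.

Fixpoint cell_high (V : seq nat) (c : seq (bool * bool)) : term :=
  match V, c with
  | i :: V, p :: c => Join (Join (if p.1 then Zero else Var i)
                                 (if p.2 then Bar (Var i) else Zero)) (cell_high V c)
  | _, _ => Zero
  end.

Definition cell V c : formula := FNeq (Meet (cell_low V c) (cell_high V c)) (cell_low V c).

Lemma eval_cell (u : nat -> four) (V : seq nat) (c : seq (bool * bool)) :
  size c = size V ->
  (eval u (cell_low V c)).1 && ~~ (eval u (cell_high V c)).1 = (map u V == c).
Proof.
elim: V c => [|i V IHV] [|p c] //= [/IHV {}IHV].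
rewrite eqseq_cons -IHV; case: p => [[] []] /=; case: (u i) => [[] []] /=;
by case: (eval u (cell_low V c)).1; case: (eval u (cell_high V c)).1.
Qed.

Lemma vars_cell (V : seq nat) (c : seq (bool * bool)) : {subset free_vars (cell V c) <= V}.
Proof.
have Hl : {subset term_vars (cell_low V c) <= V}.
  elim: V c => [|i V IHV] [|p c] //= j; rewrite inE !mem_cat => /orP [|/IHV ->].
    by case: p => [[] []] /=; rewrite ?inE ?orbF // ?orbb => ->.
  by rewrite orbT.
have Hh : {subset term_vars (cell_high V c) <= V}.
  elim: V c {Hl} => [|i V IHV] [|p c] //= j; rewrite inE !mem_cat => /orP [|/IHV ->].
    by case: p => [[] []] /=; rewrite ?inE ?orbF // ?orbb => ->.
  by rewrite orbT.
by move=> i /=; rewrite cats0 !mem_cat => /orP [/orP []|]; [apply: Hl|apply: Hh|apply: Hl].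
Qed.

Lemma sat_cell (M : structure) (v : nat -> M) (V : seq nat) (c : seq (bool * bool)) :
  de_morgan_algebra M -> size c = size V -> sat v (cell V c) <-> realizes V v c.
Proof.
move=> HM cV /=; split=> [ne|[g gc] le].
  apply: contrapT => nc; apply/ne/point_le => // g gl.
  apply: contrapT => /negP gh; apply: nc; exists g.
  by apply/eqP; rewrite -eval_cell // -!(point_eval g) gl.
have := eval_cell (g \o v) cV; rewrite gc eqxx -!(point_eval g) -le point_meet.
by case: (_.1) => //=; case: (_.1).
Qed.

(** The back-and-forth step. The realized cells index a partition of [N]; the values that [a] omits
    over each cell form a consistent triple, and the extension axiom yields [b] with the same
    values. *)
Lemma sim_extend (M N : structure) (V : seq nat) (v : nat -> M) (w : nat -> N) i (a : M) :
  de_morgan_algebra M -> is_model ECDA N -> i \notin V -> sim V v w ->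
  exists b, sim (i :: V) (update v i a) (update w i b).
Proof.
move=> HM /is_model_ECDA [HN Ncompl Next] iV vw.
have mapE (L : structure) (u : nat -> L) x (g : point L) :
    map (g \o update u i x) V = map (g \o u) V.
  by apply/eq_in_map => j jV /=; rewrite /update; case: eqP jV iV => [-> ->|].
suff [b bP] : exists b : N, forall c d,
    (exists g : point M, g a = d /\ map (g \o v) V = c) <->
    (exists g : point N, g b = d /\ map (g \o w) V = c).
  exists b => -[|d c]; first by split=> -[].
  have ui (L : structure) (u : nat -> L) x : update u i x i = x by rewrite /update eqxx.
  split=> -[g /=]; rewrite mapE ui => -[gd gc].
    have [h [hd hc]] := (bP c d).1 (ex_intro _ g (conj gd gc)).
    by exists h; rewrite /= mapE ui hd hc.
  have [h [hd hc]] := (bP c d).2 (ex_intro _ g (conj gd gc)).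
  by exists h; rewrite /= mapE ui hd hc.
pose T := (size V).-tuple (bool * bool).
pose trace (L : structure) (u : nat -> L) (g : point L) : T := map_tuple (g \o u) (in_tuple V).
pose C : {set T} := [set c : T | `[< realizes V v c >]].
have CM (c : T) : c \in C <-> exists g : point M, trace M v g = c.
  rewrite inE; split=> [/asboolP [g gc]|[g <-]]; last by apply/asboolP; exists g.
  by exists g; apply: val_inj.
have CN (c : T) : c \in C <-> exists g : point N, trace N w g = c.
  rewrite inE; split=> [/asboolP/vw [g gc]|[g <-]]; last by apply/asboolP/vw; exists g.
  by exists g; apply: val_inj.
(* The meet of [cell_low] with a complement of [cell_high] is true exactly at the points with trace
   [c]. *)
have /choice [y yP] (c : T) : exists y : N, forall g : point N,
    (g y).1 = (trace N w g == c).
  have [z [z0 z1]] := Ncompl (eval w (cell_high V c)).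
  exists (meetS (eval w (cell_low V c)) z) => g; rewrite point_meet.
  have -> : (g z).1 = ~~ (g (eval w (cell_high V c))).1.
    have := congr1 (fun x => (g x).1) z0; have := congr1 (fun x => (g x).1) z1.
    rewrite /= point_meet point_join point_zero point_one /=.
    by case: (g z).1; case: (g _).1.
  by rewrite !point_eval eval_cell ?size_tuple // -val_eqE.
have [g0] := exists_point HM.
have c0C : trace M v g0 \in C by apply/CM; exists g0.
pose sw (c : T) : T := map_tuple swap c.
have swK : involutive sw by move=> c; apply: val_inj; rewrite /= mapK //; exact: swapK.
have trace_swap (L : structure) (u : nat -> L) g :
    trace L u (swap_point g) = sw (trace L u g).
  by apply: val_inj; rewrite /= -map_comp.
have swC c : c \in C -> sw c \in C.
  by move=> /CM [g <-]; apply/CM; exists (swap_point g).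
(* The axiom is indexed by ['I_n], so the realized cells are numbered; swapping coordinates becomes
   the permutation [sigma]. *)
pose rk := enum_rank_in c0C; pose e (i : 'I_#|C|) : T := enum_val i.
have eC j : e j \in C by exact: enum_valP.
have rkK : {in C, cancel rk e} by exact: enum_rankK_in.
have sigmaK : involutive (fun j => rk (sw (e j))).
  by move=> j; rewrite rkK ?swC // swK; apply: enum_valK_in.
pose sigma : 'S_#|C| := perm (inv_inj sigmaK).
have e_sigma j : e (sigma j) = sw (e j) by rewrite permE rkK ?swC.
pose hit (L : structure) (u : nat -> L) (x : L) j d :=
  `[< exists g : point L, trace L u g = e j /\ g x = d >].
have hit_sigma (L : structure) (u : nat -> L) x j d :
    hit L u x (sigma j) (swap d) = hit L u x j d.
  apply: asbool_equiv_eq; split=> -[g [gj gx]]; exists (swap_point g);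
    by rewrite trace_swap gj e_sigma ?swK /= gx ?swapK.
(* [I d] collects the cells over which [a] never takes the value [d]. *)
pose I d : {set 'I_#|C|} := [set j | ~~ hit M v a j d].
have sigma_inv : involutive sigma by move=> j; rewrite !permE sigmaK.
have consI : consistent sigma (I (true, false)) (I (true, true)) (I (false, false)).
  apply/consistentP => //; split=> j; rewrite !inE.
  - by rewrite -(hit_sigma _ _ _ j).
  - by rewrite -(hit_sigma _ _ _ j).
  (* Some point realizes the cell [e j], and its value at [a] is one of the four, so they are not
     all omitted. *)
  have /CM [g gj] := eC j.
  have : hit M v a j (g a) by apply/asboolP; exists g.
  have := hit_sigma M v a j (false, true); rewrite /swap /= => ->.
  by case: (g a) => [[] []] ->; rewrite ?andbF.
have n_gt0 : 0 < #|C| by rewrite card_gt0; apply/set0Pn; exists (trace M v g0).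
(* The default [zeroS N] occurs only at indices that the axiom does not read. *)
pose Y k : N := if insub k is Some j then y (e j) else zeroS N.
have YE (j : 'I_#|C|) : Y j = y (e j) by rewrite /Y valK.
have [j|||j|b [b1 [z [z0 z1 b2]] [z' [z0' z1' b3]]]] :=
  (valid_extension _ _ _ _ _).1 (Next _ _ _ _ _ n_gt0 sigma_inv consI) Y.
- rewrite YE; apply/(neq_zero HN); have /CN [g gj] := eC j.
  by exists g; rewrite yP gj.
- apply: (eq_point HN) => g; rewrite point_one /=.
  rewrite (big_morph (fun x => (g x).1) (point_join g) (congr1 fst (point_zero g))).
  rewrite big_orE; apply/existsP; exists (rk (trace N w g)).
  by rewrite YE yP rkK ?eqxx //; apply/CN; exists g.
- move=> j k jk; apply/(eq_zero HN) => g; rewrite point_meet !YE !yP.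
  by apply: contraNF jk => /andP [/eqP -> /eqP/enum_val_inj ->].
- rewrite !YE; have yj (g : point N) : (g (y (e j))).2 = (g (y (e (sigma j)))).1.
    rewrite yP e_sigma -(inj_eq (inv_inj swK)) swK -trace_swap.
    exact: (yP (e j) (swap_point g)).
  split; apply: (eq_point HN) => g.
    by rewrite point_join point_bar yj point_one orNb.
  by rewrite point_meet point_bar yj point_zero andNb.
have transfer x (d : bool * bool) (j : 'I_#|C|) : (forall h : point N, (h x).1 = (h b == d)) ->
    (meetS (Y j) x = zeroS N <-> j \in I d) -> hit N w b j d = hit M v a j d.
  move=> xd; rewrite inE YE (eq_zero HN) => xI; apply/idP/idP.
    move=> /asboolP [h [hj hb]]; apply: contrapT => /negP/xI/(_ h).
    by rewrite point_meet yP hj xd hb !eqxx.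
  apply: contraTT => nN; apply/xI => h; rewrite point_meet yP xd.
  by apply: contraNF nN => /andP [/eqP hj /eqP hb]; apply/asboolP; exists h.
have hitE10 j : hit N w b j (true, false) = hit M v a j (true, false).
  apply: transfer (b1 j) => h; rewrite point_meet point_bar.
  by case: (h b) => [[] []].
have hitE j d : hit N w b j d = hit M v a j d.
  case: d => [[] []] //; last 2 first.
  (* The value (false, true) over [j] is the value (true, false) over [sigma j]. *)
  - by rewrite -hit_sigma -[RHS]hit_sigma.
  - apply: transfer (b3 j) => h; rewrite point_meet point_bar.
    have := congr1 (fun x => (h x).1) z0'; have := congr1 (fun x => (h x).1) z1'.
    rewrite /= point_meet point_join point_zero point_one /=.
    by case: (h b) => [[] []]; case: (h z').1.
  - apply: transfer (b2 j) => h; rewrite point_meet.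
    have := congr1 (fun x => (h x).1) z0; have := congr1 (fun x => (h x).1) z1.
    rewrite /= point_meet point_join point_bar point_zero point_one /=.
    by case: (h b) => [[] []]; case: (h z).1.
have hitP (L : structure) (u : nat -> L) x (g : point L) :
    trace L u g \in C -> hit L u x (rk (trace L u g)) (g x).
  by move=> gC; apply/asboolP; exists g; rewrite rkK.
exists b => c d; split=> -[g [<- <-]].
  have gC : trace M v g \in C by apply/CM; exists g.
  have := hitP M v a g gC; rewrite -hitE => /asboolP [h []].
  by rewrite rkK // => /(congr1 val) /= hg hb; exists h.
have gC : trace N w g \in C by apply/CN; exists g.
have := hitP N w b g gC; rewrite hitE => /asboolP [h []].
by rewrite rkK // => /(congr1 val) /= hg hb; exists h.
Qed.

(** Back-and-forth by induction on [p], for all pairs of models at once, since implication and the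
    universal quantifier exchange the roles of [M] and [N]. *)
Lemma sim_sat (M N : structure) (V : seq nat) (v : nat -> M) (w : nat -> N) (p : formula) :
  is_model ECDA M -> is_model ECDA N -> {subset free_vars p <= V} ->
  sim V v w -> sat v p -> sat w p.
Proof.
move=> HM HN.
elim: p M N HM HN V v w => [s t||p IHp q IHq|p IHp q IHq|p IHp q IHq|i p IHp|i p IHp]
  M N HM HN V v w pV vw //=; have [dM _ _] := (is_model_ECDA M).1 HM;
  have [dN _ _] := (is_model_ECDA N).1 HN.
- move=> st; apply: (eq_point dN) => h; rewrite !point_eval.
  have [g /eq_in_map gh] := (vw _).2 (ex_intro _ h erefl).
  have eE r : {subset term_vars r <= V} ->
      eval (h \o w : nat -> four) r = eval (g \o v : nat -> four) r.
    by move=> rV; apply: eq_in_eval => j /rV /gh.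
  by rewrite !eE -?point_eval ?st // => j jr; apply: pV; rewrite /= mem_cat jr ?orbT.
- have [pV1 pV2] : {subset free_vars p <= V} /\ {subset free_vars q <= V}.
    by split=> j jp; apply: pV; rewrite /= mem_cat jp ?orbT.
  by case=> [/(IHp M N HM HN V v w pV1 vw) ? /(IHq M N HM HN V v w pV2 vw)].
- have [pV1 pV2] : {subset free_vars p <= V} /\ {subset free_vars q <= V}.
    by split=> j jp; apply: pV; rewrite /= mem_cat jp ?orbT.
  by case=> [/(IHp M N HM HN V v w pV1 vw)|/(IHq M N HM HN V v w pV2 vw)]; auto.
- have [pV1 pV2] : {subset free_vars p <= V} /\ {subset free_vars q <= V}.
    by split=> j jp; apply: pV; rewrite /= mem_cat jp ?orbT.
  move=> pq /(IHp N M HN HM V w v pV1 (sim_sym vw)) /pq.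
  exact: (IHq M N HM HN V v w pV2 vw).
(* The value at the bound variable is about to change, so [i] is first dropped from [V]. *)
- pose W := [seq j <- V | j != i].
  have iW : i \notin W by rewrite mem_filter eqxx.
  have vwW : sim W v w by apply: sim_subset vw => j; rewrite mem_filter => /andP [].
  have pW : {subset free_vars p <= i :: W}.
    move=> j jp; rewrite inE mem_filter; case: eqP => //= /eqP ji.
    by apply: pV; rewrite /= mem_filter ji.
  move=> Hp b; have [a ab] := sim_extend b dN HM iW (sim_sym vwW).
  exact: IHp N HM HN _ _ _ pW (sim_sym ab) (Hp a).
- pose W := [seq j <- V | j != i].
  have iW : i \notin W by rewrite mem_filter eqxx.
  have vwW : sim W v w by apply: sim_subset vw => j; rewrite mem_filter => /andP [].
  have pW : {subset free_vars p <= i :: W}.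
    move=> j jp; rewrite inE mem_filter; case: eqP => //= /eqP ji.
    by apply: pV; rewrite /= mem_filter ji.
  case=> a Hp; have [b ab] := sim_extend a dM HN iW vwW.
  by exists b; apply: IHp N HM HN _ _ _ pW ab Hp.
Qed.

Lemma sat_big_or (M : structure) (v : nat -> M) (T : finType) (P : pred T)
    (F : T -> formula) :
  sat v (\big[FOr/FFalse]_(i | P i) F i) <-> exists2 i, P i & sat v (F i).
Proof.
split=> [|[i Pi Fi]]; first by elim/big_rec: _ => //= i p Pi IH [Fi|//]; exists i.
have := mem_index_enum i; elim: (index_enum T) => //= j r IHr.
rewrite inE big_cons => /predU1P [<-|/IHr]; first by rewrite Pi; left.
by case: ifP => //; right.
Qed.

Definition qf_in (V : seq nat) (p : formula) : Prop :=
  quantifier_free p /\ {subset free_vars p <= V}.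

Lemma qf_in_big (op : formula -> formula -> formula) (p0 : formula) (V : seq nat)
    (T : finType) (P : pred T) (F : T -> formula) :
  (forall p q, qf_in V p -> qf_in V q -> qf_in V (op p q)) -> qf_in V p0 ->
  (forall i, qf_in V (F i)) -> qf_in V (\big[op/p0]_(i | P i) F i).
Proof. by move=> Hop H0 HF; apply: big_ind. Qed.

Lemma qf_in_and V p q : qf_in V p -> qf_in V q -> qf_in V (FAnd p q).
Proof.
move=> [p1 p2] [q1 q2]; split; rewrite /= ?p1 // => i.
by rewrite mem_cat => /orP [/p2|/q2].
Qed.

Lemma qf_in_or V p q : qf_in V p -> qf_in V q -> qf_in V (FOr p q).
Proof. exact: qf_in_and. Qed.

Lemma qf_in_not V p : qf_in V p -> qf_in V (FNot p).
Proof. by move=> [p1 p2]; split; rewrite /= ?p1 // cats0. Qed.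

Lemma sat_iff_sim (M N : structure) (p : formula) (v : nat -> M) (w : nat -> N) :
  is_model ECDA M -> is_model ECDA N -> sim (free_vars p) v w -> sat v p <-> sat w p.
Proof.
move=> HM HN vw; split; first exact: sim_sat HM HN _ vw.
exact: sim_sat HN HM _ (sim_sym vw).
Qed.

(* p is equivalent to the disjunction of the descriptions of those (finitely many)
   sets of cells that are the set of cells realized by some tuple satisfying p. *)
Lemma ECDA_quantifier_elimination : quantifier_elimination ECDA.
Proof.
move=> p; pose V := free_vars p.
pose T := (size V).-tuple (bool * bool).
pose type (M : structure) (v : nat -> M) : {set T} := [set c : T | `[< realizes V v c >]].
(* All models are considered at once, yet [good] is a Boolean predicate on a finite type, so the
   disjunction over it is a formula. *)
pose good (P : {set T}) := `[< exists (M : structure) (v : nat -> M),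
  [/\ is_model ECDA M, type M v = P & sat v p] >].
pose describe (P : {set T}) : formula :=
  FAnd (\big[FAnd/FTrue]_(c in P) cell V c) (\big[FAnd/FTrue]_(c in ~: P) FNot (cell V c)).
have describeP (M : structure) (v : nat -> M) P : de_morgan_algebra M ->
    sat v (describe P) <-> type M v = P.
  move=> HM; have cellP (c : T) : sat v (cell V c) <-> c \in type M v.
    rewrite sat_cell ?size_tuple // inE; exact: (rwP (asboolP _)).
  rewrite /describe /=; rewrite !sat_big_and; split=> [[HP HPC]|<-].
    apply/setP => c; apply/idP/idP => [/cellP vc|/HP/cellP//].
    by apply: contrapT => /negP cP; apply: (HPC c); rewrite ?inE.
  by split=> c; [move/cellP | rewrite inE => cv /cellP; apply/negP].
have cell_qf c : qf_in V (cell V c) by split=> //; apply: vars_cell.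
have true_qf : qf_in V FTrue by [].
exists (\big[FOr/FFalse]_(P | good P) describe P).
have [q1 q2] : qf_in V (\big[FOr/FFalse]_(P | good P) describe P).
  apply: qf_in_big => // [q r|P]; first exact: qf_in_or.
  apply: qf_in_and; apply: qf_in_big => // *; [exact: qf_in_and.. | exact: qf_in_not].
split=> // M HM v; have [dM _ _] := (is_model_ECDA M).1 HM.
split.
  move=> vp; apply/sat_big_or; exists (type M v); last exact/describeP.
  by apply/asboolP; exists M, v.
(* [v] realizes the same cells as a tuple [w] satisfying [p] in a possibly different model. *)
move=> /sat_big_or [P /asboolP [N [w [HN <- wp]]] /(describeP _ _ _ dM)/setP vw].
apply/(sat_iff_sim HM HN)/wp => c.
case: (eqVneq (size c) (size V)) => [cV|ncV].
  have := vw (Tuple (introT eqP cV)); rewrite !inE /= => e.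
  by split=> /asboolP; [rewrite e | rewrite -e] => /asboolP.
(* A cell of the wrong length is realized on neither side. *)
by split=> -[g gc]; rewrite -gc size_map eqxx in ncV.
Qed.

(** * Completeness and model completion *)

Lemma quantifier_free_existential (p : formula) : quantifier_free p -> existential p.
Proof. by case: p. Qed.

Lemma ECDA_consistent : exists M, is_model ECDA M.
Proof.
have [M HM _] := DMA_embeds_ECDA ((is_model_DMA four).2 four_de_morgan).
by exists M.
Qed.

(** Without free variables the only realizable cell is the empty one, and every model has a point to
    realize it; hence all models satisfy the same sentences. *)
Lemma ECDA_complete : complete_theory ECDA.
Proof.
split=> [|p pS]; first exact: ECDA_consistent.
have sat_eq (M N : structure) (v : nat -> M) (w : nat -> N) : is_model ECDA M -> is_model ECDA N ->
    sat v p -> sat w p.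
  move=> HM HN; apply: (sat_iff_sim HM HN _).1; rewrite (nilP pS) => c.
  have [[g] [h]] : inhabited (point M) /\ inhabited (point N).
    by split; apply/exists_point; [case/is_model_ECDA: HM | case/is_model_ECDA: HN].
  by split=> -[k <-]; [exists h | exists g].
case: (pselect (entails ECDA p)) => [|np]; [by left | right=> N HN w /= wp].
by apply: np => M HM v; apply: sat_eq wp.
Qed.

Theorem theorem5p2 :
  model_completion ECDA DMA /\ complete_theory ECDA /\
  quantifier_elimination ECDA.
Proof.
split; last by split; [exact: ECDA_complete | exact: ECDA_quantifier_elimination].
split; first exact: DMA_amalgamation.
split=> [p|M|M HM].
- have [q [q_qf qV pq]] := ECDA_quantifier_elimination p.
  by exists q; split=> //; apply: quantifier_free_existential.
- exact: DMA_embeds_ECDA.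
- exists M; last by exists id; split.
  by move=> p Hp; apply: HM; do 2!constructor.
Qed.
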